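(* Let $m=p_1^{\alpha_1}\cdots p_s^{\alpha_s}$ and $n=p_1^{\beta_1}\cdots p_s^{\beta_s}$ with $n,m\geq 2$, where $p_1,\dots,p_s$ are distinct primes, the $\alpha_i$ are positive integers, and the $\beta_i$ are integers with $0\leq\beta_i\leq\alpha_i$ for $i=1,\dots,s$ (so that $n$ divides $m$ and $\mathbb{Z}_n$ is a $\mathbb{Z}_m$-module). Let $S'=\{i\in\{1,\dots,s\}:\beta_i\neq 0\}$. If $\alpha_i\leq 2\beta_i-1$ for each $i\in S'$, then $G_n(\mathbb{Z}_m)$ is weakly perfect.
   Context: $\mathbb{Z}_k$ denotes the ring of integers modulo $k$. When $n$ divides $m$, $\mathbb{Z}_n$ is regarded as a $\mathbb{Z}_m$-module in the natural way. $G_n(\mathbb{Z}_m)$ is the $\mathbb{Z}_n$-intersection graph of ideals of $\mathbb{Z}_m$: the (simple) graph whose vertices are the non-trivial ideals of $\mathbb{Z}_m$ (ideals different from $0$ and $\mathbb{Z}_m$), where two distinct vertices $I$ and $J$ are adjacent if and only if $I\mathbb{Z}_n\cap J\mathbb{Z}_n\neq 0$. A graph $G$ is weakly perfect if $\chi(G)=\omega(G)$, where $\chi$ is the chromatic number and $\omega$ the clique number (number of vertices in a largest clique); both are $0$ for a graph with no vertices. *)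

(* Defs.v *)
From HB Require Import structures.
From mathcomp Require Import all_boot all_order all_algebra all_fingroup.

Set Implicit Arguments.
Unset Strict Implicit.
Unset Printing Implicit Defensive.

Import GRing.Theory.
Local Open Scope ring_scope.

Record sgraph := SGraph {
  vertex :> finType;
  adj : rel vertex;
  adj_sym : symmetric adj;
  adj_irr : irreflexive adj
}.

Section GraphInvariants.
Variable G : sgraph.

Definition clique (A : {set G}) : bool :=
  [forall x in A, forall y in A, (x != y) ==> adj x y].

Definition clique_number : nat := \max_(A : {set G} | clique A) #|A|.

Definition colouring (k : nat) (f : {ffun G -> 'I_k}) : bool :=
  [forall x, forall y, adj x y ==> (f x != f y)].

Definition colourable (k : nat) : bool :=
  [exists f : {ffun G -> 'I_k}, colouring f].

Lemma colourable_ex : exists k, colourable k.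
Proof.
exists #|G|; apply/existsP; exists [ffun x => enum_rank x].
apply/forallP=> x; apply/forallP=> y; apply/implyP=> xy; rewrite !ffunE.
by apply: contraTneq xy => /enum_rank_inj ->; rewrite adj_irr.
Qed.

Definition chromatic_number : nat := ex_minn colourable_ex.

Definition weakly_perfect : Prop := chromatic_number = clique_number.

End GraphInvariants.

(* 'Z_k is the ring of integers modulo k only when 1 < k; everything below is *)
(* meant for 1 < m and 1 < n.                                                 *)

Definition is_ideal (m : nat) (I : {set 'Z_m}) : bool :=
  [&& 0 \in I,
      [forall x in I, forall y in I, x + y \in I] &
      [forall a : 'Z_m, forall x in I, a * x \in I]].

Definition nontrivial_ideal (m : nat) (I : {set 'Z_m}) : bool :=
  [&& is_ideal I, I != [set 0] & I != [set: 'Z_m]].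

(* The scalar action of 'Z_m on 'Z_n: the class of k acts as multiplication   *)
(* by k. It is computed on the representative of a in [0, m), which is        *)
(* immaterial when n divides m (Zm_actE).                                     *)
Definition Zm_act (m n : nat) (a : 'Z_m) (x : 'Z_n) : 'Z_n := x *+ (a : nat).

Lemma Zm_actE (m n k : nat) (x : 'Z_n) :
  (1 < m)%N -> (1 < n)%N -> (n %| m)%N -> Zm_act (k%:R : 'Z_m) x = x *+ k.
Proof.
move=> m1 n1 nm; rewrite /Zm_act val_Zp_nat // -mulr_natr -[RHS]mulr_natr.
by congr (_ * _); apply/val_inj; rewrite /= !val_Zp_nat // modn_dvdm.
Qed.

(* I Z_n, the set of finite sums of products a x with a in I and x in Z_n;    *)
(* the group law that << _ >> refers to on 'Z_n is addition.                  *)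
Definition ideal_mod (m n : nat) (I : {set 'Z_m}) : {set 'Z_n} :=
  <<[set Zm_act a x | a in I, x in [set: 'Z_n]]>>%g.

Section IntersectionGraph.
Variables n m : nat.

Definition nt_ideal : finType := {I : {set 'Z_m} | nontrivial_ideal I}.

Definition ideal_adj : rel nt_ideal := fun I J =>
  (I != J) && (ideal_mod n (val I) :&: ideal_mod n (val J) != [set 0]).

Lemma ideal_adj_sym : symmetric ideal_adj.
Proof. by move=> I J; rewrite /ideal_adj eq_sym setIC. Qed.

Lemma ideal_adj_irr : irreflexive ideal_adj.
Proof. by move=> I; rewrite /ideal_adj eqxx. Qed.

Definition intersection_graph : sgraph := SGraph ideal_adj_sym ideal_adj_irr.

End IntersectionGraph.

(* Main.v *)
(** Label an ideal [I] of [Z_m] with the set [A(I)] of those [i] for which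
    [p_i ^ beta_i] does not divide all of [I]. Two distinct ideals are adjacent
    exactly when their labels meet. If [T] is included in [U], then
    [I |-> (I : q)], with [q] the product of the [p_i ^ beta_i] for [i] in
    [U \ T], injects the ideals of label [T] into those of label [U]; the bound
    on [alpha] ensures that dividing by [q] puts [U \ T] in the label. So, in
    each pair [T], [S' \ T], keep the label carried by more ideals, breaking
    ties by membership of a fixed [i0] in [S']. By monotonicity any two kept
    labels meet, so the vertices with a kept label form a clique, and the
    vertices with a discarded label [T] can reuse the colours of the vertices
    with label [S' \ T], to which they are not adjacent. *)

Require Import Defs.
From HB Require Import structures.
From mathcomp Require Import all_boot all_order all_algebra all_fingroup.

Set Implicit Arguments.
Unset Strict Implicit.
Unset Printing Implicit Defensive.

Import GRing.Theory.

(** * Cliques and colourings of a finite graph *)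

Lemma clique_number_le_chromatic (G : sgraph) :
  clique_number G <= chromatic_number G.
Proof.
rewrite /chromatic_number; case: ex_minnP => k /existsP[f /forallP f_col] _.
apply/bigmax_leqP => A /forall_inP A_clique.
rewrite -[k in _ <= k]card_ord; apply: (@leq_card_in _ _ f) => x y xA yA fxy.
apply: contra_eq (fxy) => xNy.
have /forall_inP/(_ y yA)/implyP/(_ xNy) xy := A_clique x xA.
by have /forallP/(_ y)/implyP/(_ xy) := f_col x.
Qed.

(** The vertices of [K] serve as colours: [x] gets the colour [phi x], numbered by its rank in
    [K]. *)
Lemma colourable_map (G : sgraph) (K : {set G}) (phi : G -> G) :
  (forall x, phi x \in K) -> (forall x y, adj x y -> phi x != phi y) ->
  colourable G #|K|.
Proof.
move=> phiK phi_adj; apply/existsP.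
exists [ffun x => enum_rank_in (phiK x) (phi x)].
apply/forallP => x; apply/forallP => y; apply/implyP => /phi_adj; rewrite !ffunE.
apply: contra => /eqP/(congr1 enum_val).
by rewrite !enum_rankK_in // => ->.
Qed.

(** * Graphs whose adjacency means that labels meet *)

Section LabelledGraph.
Variables (I : finType) (S : {set I}).

Lemma weakly_perfect_labelled (G : sgraph) (A : G -> {set I})
    (F : pred {set I}) :
  (forall x, A x \subset S) ->
  (forall x y, adj x y = (x != y) && (A x :&: A y != set0)) ->
  (forall T U, F T -> F U -> T :&: U != set0) ->
  (forall x, ~~ F (A x) -> F (S :\: A x) /\
     #|[set y | A y == A x]| <= #|[set y | A y == S :\: A x]|) ->
  weakly_perfect G.
Proof.
move=> AS adjE F_meet F_compl; pose K := [set x | F (A x)].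
have K_clique : clique K.
  apply/forall_inP => x; rewrite inE => Fx; apply/forall_inP => y.
  by rewrite inE => Fy; apply/implyP => xNy; rewrite adjE xNy F_meet.
apply/eqP; rewrite eqn_leq clique_number_le_chromatic andbT.
apply: (@leq_trans #|K|); last exact: bigmax_sup K_clique _.
pose cls T := enum [set y | A y == T].
(* A vertex outside [K] borrows the vertex at the same position in the complementary class. That
   class is at least as large, so the default of [nth] is never returned. *)
pose phi x := if F (A x) then x
              else nth x (cls (S :\: A x)) (index x (cls (A x))).
have idx x : ~~ F (A x) -> index x (cls (A x)) < size (cls (S :\: A x)).
  move=> /F_compl[_]; rewrite /cls -!cardE; apply: leq_trans.
  by rewrite cardE index_mem mem_enum inE.
have A_phi x : ~~ F (A x) -> A (phi x) = S :\: A x.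
  move=> NFx; rewrite /phi (negPf NFx).
  by have := mem_nth x (idx x NFx); rewrite mem_enum inE => /eqP.
have phiK x : phi x \in K.
  rewrite inE; have [Fx|NFx] := boolP (F (A x)); first by rewrite /phi Fx.
  by rewrite A_phi //; case: (F_compl x NFx).
suff phi_adj x y : adj x y -> phi x != phi y.
  rewrite /chromatic_number; case: ex_minnP => k _; apply.
  exact: colourable_map phiK phi_adj.
(* A discarded vertex [t] and its colour carry complementary labels. Hence a kept vertex with the
   same colour, being that colour itself, is not adjacent to [t]. *)
have compl_meet z t : ~~ F (A t) -> phi t = z -> A z :&: A t = set0.
  by move=> NFt <-; rewrite A_phi // setIDAC -setIDA setDv setI0.
rewrite adjE => /andP[xNy meet_xy]; apply/eqP => e.
have [Fx|NFx] := boolP (F (A x)); have [Fy|NFy] := boolP (F (A y)).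
- by move: e xNy; rewrite /phi Fx Fy => ->; rewrite eqxx.
- move: meet_xy; rewrite (compl_meet x y) ?eqxx //.
  by rewrite -e /phi Fx.
- move: meet_xy; rewrite setIC (compl_meet y x) ?eqxx //.
  by rewrite e /phi Fy.
(* Two discarded vertices of the same colour have the same complementary label, hence lie in one
   class; there the position determines the vertex. *)
have Axy : A x = A y.
  have : S :\: A x = S :\: A y by rewrite -!A_phi ?e.
  by move=> /(congr1 (setD S)); rewrite !setDDr !setDv !set0U !(setIidPr _) ?AS.
move: e (idx x NFx) (idx y NFy).
rewrite /phi (negPf NFx) (negPf NFy) Axy => e ix iy.
have := e; rewrite (set_nth_default y x ix) => /eqP.
rewrite nth_uniq ?enum_uniq // => /eqP /index_inj exy.
by move: xNy; rewrite exy ?eqxx // mem_enum inE ?Axy.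
Qed.

Variables (w : {set I} -> nat) (i0 : I).
Hypothesis (i0S : i0 \in S).
Hypothesis (w_mono : forall T U : {set I}, T \subset U -> U \subset S -> w T <= w U).

Definition heavy (T : {set I}) : bool :=
  (T \subset S) &&
  ((w (S :\: T) < w T) || ((w (S :\: T) == w T) && (i0 \in T))).

Lemma heavy_le T : heavy T -> w (S :\: T) <= w T.
Proof. by case/andP=> _ /orP[/ltnW//|/andP[/eqP-> _]]. Qed.

(** If [T] and [U] were disjoint, each would lie in the complement of the other, so [w T <= w (S :\:
    U) <= w U <= w (S :\: T) <= w T]. All four weights are then equal, and both ties are won by
    containing [i0], a common element. *)
Lemma heavy_meet T U : heavy T -> heavy U -> T :&: U != set0.
Proof.
move=> hT hU; apply: contraTneq (isT) => TU0.
have [TS] := andP hT; have [US] := andP hU.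
have leT : w T <= w (S :\: U).
  by apply: w_mono; rewrite ?subsetDl // subsetD TS -setI_eq0 TU0 eqxx.
have leU : w U <= w (S :\: T).
  by apply: w_mono; rewrite ?subsetDl // subsetD US -setI_eq0 setIC TU0 eqxx.
have leTU := leq_trans leT (heavy_le hU); have leUT := leq_trans leU (heavy_le hT).
rewrite !ltnNge (leq_trans leUT leT) (leq_trans leTU leU) /=.
move=> /andP[_ i0U] /andP[_ i0T].
by have := in_set0 i0; rewrite -TU0 inE i0T i0U.
Qed.

Lemma heavy_compl (T : {set I}) : T \subset S -> ~~ heavy T ->
  heavy (S :\: T) /\ w T <= w (S :\: T).
Proof.
rewrite /heavy subsetDl setDDr setDv set0U => TS; rewrite (setIidPr TS) TS /=.
rewrite inE i0S andbT negb_or negb_and -leqNgt; case: ltngtP => //= _ _ ->.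
Qed.

End LabelledGraph.

(** * Divisibility of representatives by a divisor of the modulus *)

Local Open Scope ring_scope.

Lemma dvdn_Zp k q a : (1 < k)%N -> (q %| k)%N ->
  (q %| ((a%:R : 'Z_k)%R : nat))%N = (q %| a)%N.
Proof.
by move=> k1 qk; rewrite val_Zp_nat // /dvdn modn_dvdm.
Qed.

Lemma dvdn_ZpD k q (x y : 'Z_k) : (1 < k)%N -> (q %| k)%N ->
  (q %| ((x + y)%R : nat))%N = (q %| (x : nat) + (y : nat))%N.
Proof.
by move=> k1 qk; rewrite -[x in LHS]natr_Zp -[y in LHS]natr_Zp -natrD dvdn_Zp.
Qed.

Lemma dvdn_ZpMn k q a (x : 'Z_k) : (1 < k)%N -> (q %| k)%N ->
  (q %| ((x *+ a)%R : nat))%N = (q %| (x : nat) * a)%N.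
Proof.
by move=> k1 qk; rewrite -[x in LHS]natr_Zp -mulrnA dvdn_Zp.
Qed.

(** * Elements of the submodule generated by an ideal *)

Section IdealMod.
Variables m n : nat.
Hypothesis n_gt1 : (1 < n)%N.

Lemma mem_ideal_mod (I : {set 'Z_m}) (x : 'Z_m) (z : 'Z_n) :
  x \in I -> z *+ x \in ideal_mod n I.
Proof. by move=> xI; apply: mem_gen; apply: imset2_f. Qed.

(** Since [q] divides [n], the multiples of [q] form an additive subgroup of ['Z_n], and this
    subgroup contains all the generators. *)
Lemma ideal_mod_dvdn q (I : {set 'Z_m}) (y : 'Z_n) : (q %| n)%N ->
  (forall x, x \in I -> (q %| (x : nat))%N) -> y \in ideal_mod n I ->
  (q %| (y : nat))%N.
Proof.
move=> qn qI; pose H := [set z : 'Z_n | (q %| (z : nat))%N].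
have H_group : group_set H.
  apply/group_setP; split=> [|x z]; first by rewrite inE dvdn0.
  by rewrite !inE => qx qz; rewrite dvdn_ZpD // dvdn_add.
suff : ideal_mod n I \subset Group H_group by move=> /subsetP sIH /sIH; rewrite inE.
rewrite gen_subG; apply/subsetP => _ /imset2P[a z aI _ ->].
by rewrite inE dvdn_ZpMn // dvdn_mull // qI.
Qed.

End IdealMod.

(** * Labels of ideals, and adjacency in terms of labels *)

Section Labels.
Variables (s : nat) (p alpha beta : 'I_s -> nat) (m n : nat).
Hypotheses (p_prime : forall i, prime (p i)) (p_inj : injective p)
  (beta_le : forall i, (beta i <= alpha i)%N)
  (m_def : m = (\prod_(i < s) p i ^ alpha i)%N)
  (n_def : n = (\prod_(i < s) p i ^ beta i)%N)
  (m_gt1 : (1 < m)%N) (n_gt1 : (1 < n)%N)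
  (alpha_lt : forall i, beta i != 0%N -> (alpha i < beta i + beta i)%N).

Let b i := (p i ^ beta i)%N.

Definition supp : {set 'I_s} := [set i | beta i != 0%N].

Definition label (I : {set 'Z_m}) : {set 'I_s} :=
  [set i | [exists x in I, ~~ (b i %| (x : nat))%N]].

Lemma labelP (I : {set 'Z_m}) i :
  reflect (forall x, x \in I -> b i %| (x : nat))%N (i \notin label I).
Proof.
rewrite inE negb_exists_in; apply: (iffP forall_inP) => bI x /bI;
  by rewrite negbK.
Qed.

Lemma coprime_prod_pow (P : pred 'I_s) (e : 'I_s -> nat) i c : ~~ P i ->
  coprime (p i ^ c) (\prod_(j < s | P j) p j ^ e j).
Proof.
move=> NPi; elim/big_ind: _ => [|x y cx cy|j Pj]; first exact: coprimen1.
  by rewrite coprimeMr cx cy.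
rewrite coprimeXl // coprimeXr // prime_coprime // dvdn_prime2 //.
by apply: contraNneq NPi => /p_inj->.
Qed.

Lemma dvdn_prod_pow (P : pred 'I_s) (e : 'I_s -> nat) d :
  (forall i, P i -> p i ^ e i %| d)%N -> (\prod_(j < s | P j) p j ^ e j %| d)%N.
Proof.
move=> ed; have [k] := ubnP #|P|; elim: k P ed => // k IH P ed Pk.
have [i Pi|P0] := pickP P; last by rewrite big_pred0 ?dvd1n.
rewrite (bigD1 i) //= Gauss_dvd; last by apply: coprime_prod_pow; rewrite eqxx andbF.
rewrite ed //=; apply: IH => [j /andP[/ed //]|].
rewrite (cardD1 i) in Pk; rewrite [i \in P]Pi ltnS in Pk.
apply: leq_ltn_trans Pk; apply: subset_leq_card; apply/subsetP => j.
by rewrite !inE andbC.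
Qed.

Lemma pow_beta_dvd_n i : (b i %| n)%N.
Proof. by rewrite n_def (bigD1 i) //= dvdn_mulr. Qed.

Lemma n_dvd_m : (n %| m)%N.
Proof.
rewrite n_def m_def; elim/big_ind2: _ => // [x y z t|i _]; first exact: dvdn_mul.
exact: dvdn_exp2l.
Qed.

Lemma pow_beta_dvd_m i : (b i %| m)%N.
Proof. exact: dvdn_trans (pow_beta_dvd_n i) n_dvd_m. Qed.

(** This is where the bound on [alpha] enters: the exponent of [p i] in [m] is below
    [2 * beta i]. *)
Lemma sqr_pow_beta_ndvd_m i : i \in supp -> ~~ (b i * b i %| m)%N.
Proof.
rewrite inE => /alpha_lt lt_i; rewrite -expnD m_def (bigD1 i) //=.
rewrite Gauss_dvdl; last by apply: coprime_prod_pow; rewrite eqxx.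
by rewrite dvdn_Pexp2l ?prime_gt1 // -ltnNge.
Qed.

Lemma label_sub I : label I \subset supp.
Proof.
apply/subsetP => i; apply: contraLR; rewrite inE negbK => /eqP bi0.
by apply/labelP => x _; rewrite /b bi0 dvd1n.
Qed.

Lemma label0 : label [set 0] = set0.
Proof.
apply/setP => i; rewrite [in RHS]inE; apply/negbTE/labelP => x.
by rewrite inE => /eqP->; rewrite dvdn0.
Qed.

Lemma labelT : label setT = supp.
Proof.
apply/eqP; rewrite eqEsubset label_sub; apply/subsetP => i.
rewrite !inE => bi0; apply/exists_inP; exists 1; rewrite ?inE //.
rewrite -[1]/(1%:R) dvdn_Zp ?pow_beta_dvd_m // dvdn1 /b.
by rewrite -(exp1n (beta i)) eqn_exp2r ?lt0n // neq_ltn prime_gt1 ?orbT.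
Qed.

Lemma supp_neq0 : exists i, i \in supp.
Proof.
have [i bi|b0] := pickP [pred i | beta i != 0%N]; first by exists i; rewrite inE.
move: n_gt1; rewrite n_def big1 // => i _.
by have /negbFE/eqP-> := b0 i.
Qed.

Lemma is_idealM (I : {set 'Z_m}) a x : is_ideal I -> x \in I -> a * x \in I.
Proof.
by case/and3P=> _ _ /forallP/(_ a)/forall_inP aI /aI.
Qed.

Lemma is_idealD (I : {set 'Z_m}) x y :
  is_ideal I -> x \in I -> y \in I -> x + y \in I.
Proof.
by case/and3P=> _ /forall_inP DI _ /DI/forall_inP; apply.
Qed.

(** Some [x] in [I] is not divisible by [b i], so [gcdn x n] has a smaller [p i]-part than [n] and
    divides [n %/ p i]; by Bezout, [n %/ p i] is then a multiple of [x] modulo [n]. *)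
Lemma n_div_p_mem_ideal_mod (I : {set 'Z_m}) i :
  i \in label I -> (n %/ p i)%:R \in ideal_mod n I.
Proof.
rewrite inE => /exists_inP[x xI bx].
have [u ux] : exists u, (n %/ p i = u * x %[mod n])%N.
  have g_dvd : (gcdn x n %| n %/ p i)%N.
    have bi0 : beta i != 0%N by apply: contraNneq bx => bi0; rewrite /b bi0.
    have pn : (p i %| n)%N.
      by apply: dvdn_trans (pow_beta_dvd_n i); rewrite /b dvdn_exp ?lt0n.
    have gn := dvdn_gcdr x n.
    (* If [p i] did not divide the cofactor of the gcd in [n], the whole of [b i] would divide the
       gcd, hence [x]. *)
    have [pg|] := boolP (p i %| n %/ gcdn x n)%N.
      by rewrite dvdn_divRL // mulnC -dvdn_divRL.
    rewrite -prime_coprime // => cop; case/negP: bx.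
    apply: dvdn_trans (dvdn_gcdl x n).
    rewrite -(@Gauss_dvdr _ (n %/ gcdn x n)) ?coprimeXl //.
    by rewrite divnK // pow_beta_dvd_n.
  (* The Bezout lemma [egcdnP] asks for a positive [x]. *)
  have [g0|x0] := posnP x.
    by exists 0%N; move: g_dvd; rewrite g0 gcd0n mul0n => /eqP->; rewrite mod0n.
  case: (egcdnP n x0) => ku kv e _.
  exists (n %/ p i %/ gcdn x n * ku)%N.
  by rewrite -mulnA e mulnDr mulnA modnMDl divnK.
have -> : (n %/ p i)%:R = (u%:R : 'Z_n) *+ x.
  by rewrite -mulrnA -Zp_nat_mod // ux Zp_nat_mod.
exact: mem_ideal_mod.
Qed.

(** A common index [i] puts the nonzero class of [n %/ p i] in both submodules. If the labels are
    disjoint, each [b i] divides every element of one of the two submodules, so [n] divides every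
    common element. *)
Lemma ideal_mod_meet (I J : {set 'Z_m}) :
  (ideal_mod n I :&: ideal_mod n J != [set 0]) = (label I :&: label J != set0).
Proof.
apply/idP/idP => [|/set0Pn[i]]; last first.
  rewrite inE => /andP[iI iJ]; apply: contraTneq isT => e.
  have := n_div_p_mem_ideal_mod iI; have := n_div_p_mem_ideal_mod iJ.
  move=> yJ yI; have : (n %/ p i)%:R \in [set 0 : 'Z_n] by rewrite -e inE yI yJ.
  have pn : (p i %| n)%N.
    apply: dvdn_trans (pow_beta_dvd_n i); rewrite dvdn_exp // lt0n.
    by move/subsetP: (label_sub I) => /(_ i iI); rewrite inE.
  rewrite inE -val_eqE /= val_Zp_nat // modn_small; last first.
    by rewrite ltn_Pdiv ?prime_gt1 // ltnW.
  by rewrite -leqn0 leqNgt divn_gt0 ?prime_gt0 // dvdn_leq // ltnW.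
apply: contra_neq => meet0; apply/eqP; rewrite eqEsubset andbC sub1set inE !group1 /=.
apply/subsetP => y; rewrite inE => /andP[yI yJ]; rewrite inE -val_eqE /=.
have : (n %| (y : nat))%N.
  rewrite [n in (n %| _)%N]n_def; apply: dvdn_prod_pow => i _.
  have [iI|/labelP iI] := boolP (i \in label I); last first.
    exact: ideal_mod_dvdn (pow_beta_dvd_n i) iI yI.
  apply: (ideal_mod_dvdn n_gt1 (pow_beta_dvd_n i)) yJ.
  by apply/labelP/negP => iJ; have := in_set0 i; rewrite -meet0 inE iI iJ.
apply: contraLR; rewrite -lt0n => y0; apply/negP => /(dvdn_leq y0).
by rewrite leqNgt -[n in (_ < n)%N]Zp_cast // ltn_ord.
Qed.

(** * Counting the ideals with a given label *)

Definition ideals_of_label (T : {set 'I_s}) : {set {set 'Z_m}} :=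
  [set I | is_ideal I & label I == T].

(** Every element of an ideal [I] of label [T] is a multiple of [q], so [I] is recovered from its
    colon ideal as [q] times it. It remains to see that the colon ideal has label [U]. *)
Lemma card_ideals_of_label (T U : {set 'I_s}) :
  T \subset U -> U \subset supp ->
  (#|ideals_of_label T| <= #|ideals_of_label U|)%N.
Proof.
move=> TU US; pose q := (\prod_(i in U :\: T) b i)%N.
have q_dvd I x : I \in ideals_of_label T -> x \in I -> (q %| (x : nat))%N.
  rewrite inE => /andP[_ /eqP lI] xI; apply: dvdn_prod_pow => i.
  by rewrite inE -lI => /andP[/labelP bI _]; apply: bI.
have qm : (q %| m)%N by apply: dvdn_prod_pow => i _; apply: pow_beta_dvd_m.
pose colon (I : {set 'Z_m}) := [set x : 'Z_m | q%:R * x \in I].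
have divq I x : I \in ideals_of_label T -> x \in I ->
    exists2 y, y \in colon I & x = q%:R * y.
  move=> IT xI; have xE : x = q%:R * ((x : nat) %/ q)%N%:R.
    by rewrite -natrM mulnC divnK ?natr_Zp // (q_dvd I x IT xI).
  by exists (((x : nat) %/ q)%N%:R); rewrite ?inE -?xE.
have colon_inj : {in ideals_of_label T &, injective colon}.
  have sub I J : I \in ideals_of_label T -> colon I = colon J -> I \subset J.
    move=> IT e; apply/subsetP => x xI; have [y] := divq I x IT xI.
    by rewrite e inE => qy ->.
  by move=> I J IT JT e; apply/eqP; rewrite eqEsubset !sub.
rewrite -(card_in_imset colon_inj); apply/subset_leq_card/subsetP.
move=> _ /imsetP[I IT ->]; have := IT; rewrite inE => /andP[Iid /eqP lI].
have I0 : 0 \in I by case/and3P: Iid.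
rewrite inE; apply/andP; split.
  apply/and3P; split; first by rewrite inE mulr0.
    apply/forall_inP => x; rewrite inE => xI; apply/forall_inP => y.
    by rewrite !inE => yI; rewrite mulrDr is_idealD.
  apply/forallP => a; apply/forall_inP => x; rewrite !inE => xI.
  by rewrite mulrCA is_idealM.
apply/eqP/setP => i; have [iUT|iUT] := boolP (i \in U :\: T).
  have iU : i \in U by move: iUT; rewrite inE => /andP[].
  rewrite iU; apply/negPn/negP => /labelP b_colon.
  (* The class of [m %/ q] is in the colon ideal, being sent to zero by [q]. If [b i] divided it,
     then, as [b i] divides [q] too, the square of [b i] would divide [m]. *)
  have : (m %/ q)%:R \in colon I.
    by rewrite inE -natrM mulnC divnK // pchar_Zp.
  move=> /b_colon; rewrite dvdn_Zp ?pow_beta_dvd_m // => bmq.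
  have := sqr_pow_beta_ndvd_m (subsetP US i iU).
  case/negP; rewrite -(divnK qm) dvdn_mul // /q (bigD1 i) //= dvdn_mulr //.
(* Away from [U :\: T], the sets [T] and [U] agree, and [q] is coprime to [b i], so division by [q]
   does not affect divisibility by [b i]. *)
have cop_q : coprime (b i) q by apply: coprime_prod_pow.
have -> : (i \in U) = (i \in label I).
  rewrite lI; move: iUT; rewrite inE negb_and negbK.
  by case/orP=> [iT|iU]; [rewrite iT (subsetP TU)|rewrite (negPf iU)
    (contraNF (subsetP TU i))].
apply: negb_inj; apply/labelP/labelP => bI x.
  case/(divq I x IT) => y /bI by_ ->.
  by rewrite mulr_natl dvdn_ZpMn ?pow_beta_dvd_m // dvdn_mulr.
rewrite inE => /bI; rewrite mulr_natl dvdn_ZpMn ?pow_beta_dvd_m //.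
by rewrite Gauss_dvdl.
Qed.

Lemma set0_neq_setT : [set 0 : 'Z_m] != setT.
Proof.
by apply/eqP => /setP/(_ 1); rewrite !inE oner_eq0.
Qed.

Lemma is_ideal0 : is_ideal [set 0 : 'Z_m].
Proof.
apply/and3P; split; first by rewrite inE.
  apply/forall_inP => x /set1P->; apply/forall_inP => y /set1P->.
  by rewrite addr0 inE.
by apply/forallP => a; apply/forall_inP => x /set1P->; rewrite mulr0 inE.
Qed.

Lemma is_idealT : is_ideal [set: 'Z_m].
Proof.
apply/and3P; split; first by rewrite inE.
  by apply/forall_inP => x _; apply/forall_inP => y _; rewrite inE.
by apply/forallP => a; apply/forall_inP => x _; rewrite inE.
Qed.

(** The two excluded ideals, zero and the whole ring, have labels [set0] and [supp]. *)
Lemma card_nt_ideals_of_label T :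
  #|[set I : nt_ideal m | label (val I) == T]| =
  (#|ideals_of_label T| - ((T == set0) + (T == supp)))%N.
Proof.
rewrite -(card_imset _ val_inj) (cardsD1 [set 0] (ideals_of_label T)).
rewrite (cardsD1 setT (_ :\ _)) addnA !inE is_ideal0 is_idealT label0 labelT /=.
rewrite eq_sym [supp == T]eq_sym [setT == _]eq_sym set0_neq_setT /= addKn.
apply: eq_card => I.
rewrite !inE; apply/imsetP/and4P => [[J lJ ->]|[IT I0 Iid lI]].
  by have /and3P[Jid J0 JT] := valP J; rewrite inE in lJ.
have Int : nontrivial_ideal I by apply/and3P.
by exists (exist _ I Int); rewrite ?inE.
Qed.

Lemma weakly_perfect_intersection_graph :
  weakly_perfect (intersection_graph n m).
Proof.
have [i0 i0S] := supp_neq0.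
pose w T := #|ideals_of_label T|.
apply: (@weakly_perfect_labelled _ supp (intersection_graph n m)
  (fun I => label (val I)) (heavy supp w i0)).
- by move=> I; apply: label_sub.
- by move=> I J; rewrite /= /ideal_adj ideal_mod_meet.
- by move=> T U; apply: heavy_meet; apply: card_ideals_of_label.
move=> I /(heavy_compl i0S (label_sub _))[hC wle]; split => //.
(* The weight [w] counts all ideals, the trivial ones included. Taking complements in [supp]
   exchanges [set0] and [supp], so both sides lose the same number and the inequality survives. *)
have IS := label_sub (val I); rewrite !card_nt_ideals_of_label.
have -> : (supp :\: label (val I) == set0) = (label (val I) == supp).
  by rewrite setD_eq0 eqEsubset IS.
have -> : (supp :\: label (val I) == supp) = (label (val I) == set0).
  by rewrite eqEsubset subsetDl subsetD subxx disjoint_sym -setI_eq0 (setIidPl IS).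
by rewrite [(_ + (_ == set0))%N]addnC leq_sub2r.
Qed.

End Labels.

Local Close Scope ring_scope.

Theorem theorem9 (s : nat) (p alpha beta : 'I_s -> nat) (m n : nat)
  (p_prime : forall i, prime (p i))
  (p_inj : injective p)
  (alpha_gt0 : forall i, 0 < alpha i)
  (beta_le : forall i, beta i <= alpha i)
  (m_def : m = \prod_(i < s) p i ^ alpha i)
  (n_def : n = \prod_(i < s) p i ^ beta i)
  (m_ge2 : 2 <= m) (n_ge2 : 2 <= n)
  (alpha_le : forall i, i \in [set j : 'I_s | beta j != 0] ->
                alpha i <= 2 * beta i - 1) :
  weakly_perfect (intersection_graph n m).
Proof.
apply: weakly_perfect_intersection_graph p_prime p_inj beta_le m_def n_def
  _ _ _ => //.
move=> i bi; have := alpha_le i; rewrite inE => /(_ bi) le_i.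
(* Subtraction is truncated, so the strict bound uses that [beta i] is nonzero. *)
by apply: leq_ltn_trans le_i _; rewrite mul2n -addnn ltn_subrL addn_gt0 !lt0n bi.
Qed.
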